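(* Let $(M^3,g)$ be a 3-dimensional pseudo-Riemannian manifold with Lorentzian metric $g$, and let $\alpha: I\subset\mathbb{R}\to M^3$ be a non-null unit speed Frenet curve with nowhere zero curvature $\kappa$ and torsion $\tau$. Assume that $\alpha$ is not a helix. Let $f:M^3\to\mathbb{R}$ be a smooth function which is eikonal along $\alpha$ and whose Hessian satisfies $H^f=0$. Let $\alpha$ be a non-normed non-null $f$-eikonal Darboux helix with Darboux vector $W=\tau V_1-\kappa V_3$. Then $\alpha$ is a non-null $f$-eikonal slant helix if and only if $\|W\|$ is a non-zero constant along $\alpha$.
   Context: The metric $g$ is Lorentzian of signature $(-,+,+)$, $M^3$ is time-oriented, and $\nabla$ denotes its Levi-Civita connection. A unit speed non-null curve $\alpha(s)$ satisfies $g(\alpha',\alpha')=\varepsilon_1=\pm1$; it is a Frenet curve if $g(\alpha'',\alpha'')\neq0$, where $\alpha''=\nabla_{\alpha'}\alpha'$. Such a curve has an orthonormal Frenet frame $\{V_1=\alpha',V_2,V_3\}$ along it with $\varepsilon_i=g(V_i,V_i)=\pm1$, $\varepsilon_3=-\varepsilon_1\varepsilon_2$, satisfying $$\nabla_{V_1}V_1=\varepsilon_2\kappa V_2,\quad \nabla_{V_1}V_2=-\varepsilon_1\kappa V_1-\varepsilon_3\tau V_3,\quad \nabla_{V_1}V_3=\varepsilon_2\tau V_2,$$ where $\kappa\ge 0$ is the curvature and $\tau$ the torsion. We write $\|X\|=\sqrt{|g(X,X)|}$, so $\|W\|=\sqrt{|\varepsilon_1\tau^2+\varepsilon_3\kappa^2|}$.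 ''Helix'' means general helix: the ratio $\tau/\kappa$ is constant along $\alpha$. For $f:M^3\to\mathbb{R}$ smooth, $\nabla f$ is the gradient, $g(\nabla f,X)=X(f)$, and the Hessian is $H^f(X,Y)=g(\nabla_X(\nabla f),Y)$. The function $f$ is eikonal along $\alpha$ if $\|\nabla f\|$ is constant along $\alpha$. Suppose $f$ is eikonal along $\alpha$. - $\alpha$ is a non-null $f$-eikonal slant helix if the function $g(\nabla f,V_2)$ is a non-zero constant along $\alpha$. - $\alpha$ is a non-normed non-null $f$-eikonal Darboux helix if $g(W,\nabla f)$ is constant along $\alpha$, where $W=\tau V_1-\kappa V_3$.
   Formalization: The formal theorem additionally assumes that ∇f is non-zero at some point of α; without this the claim fails, e.g. for constant f and a curve in Minkowski 3-space with ε₂=1, κ=cosh s, τ=sinh s, s>0, where ‖W‖=1 but g(∇f,V₂)=0. *)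

(* Defs.v *)
From mathcomp Require Import all_boot all_order all_algebra.
From mathcomp Require Import all_classical all_reals all_analysis.
From mathcomp Require Import ring.

Set Implicit Arguments.
Unset Strict Implicit.
Unset Printing Implicit Defensive.

Import Order.TTheory GRing.Theory Num.Theory.
Import numFieldNormedType.Exports.

Local Open Scope classical_set_scope.
Local Open Scope ring_scope.

(* [Ck k U f]: f is k times continuously differentiable on the open set U;
   df is C^k as soon as all the directional derivatives v |-> 'D_v f are. *)
Fixpoint Ck (R : realType) (V W : normedModType R) (k : nat) (U : set V)
    (f : V -> W) : Prop :=
  match k with
  | 0 => forall x, U x -> {for x, continuous f}
  | k'.+1 => (forall x, U x -> differentiable f x) /\
             (forall v : V, Ck k' U ('D_v f))
  end.

Definition smooth_on (R : realType) (V W : normedModType R) (U : set V)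
    (f : V -> W) : Prop :=
  forall k, Ck k U f.

(* A chart is a homeomorphism from the open set [cdom] onto the open set [ccod];
   the values of [cmap] outside [cdom] and of [cinv] outside [ccod] are junk. *)
Record chart (R : realType) (n : nat) (M : topologicalType) := Chart {
  cmap : M -> 'rV[R]_n;
  cinv : 'rV[R]_n -> M;
  cdom : set M;
  ccod : set 'rV[R]_n;
  cdom_open : open cdom;
  ccod_open : open ccod;
  cmap_cod : forall p, cdom p -> ccod (cmap p);
  cinv_dom : forall x, ccod x -> cdom (cinv x);
  cmapK : forall p, cdom p -> cinv (cmap p) = p;
  cinvK : forall x, ccod x -> cmap (cinv x) = x;
  cmap_cont : forall p, cdom p -> {for p, continuous cmap};
  cinv_cont : forall x, ccod x -> {for x, continuous cinv} }.

(* The atlas need not be maximal. [chart_at p] is a preferred chart around p;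
   it is not required to depend on p in any regular way. *)
Record manifold (R : realType) (n : nat) := Manifold {
  carrier :> topologicalType;
  atlas : set (chart R n carrier);
  chart_at : carrier -> chart R n carrier;
  manifold_hausdorff : hausdorff_space carrier;
  manifold_second_countable : @second_countable carrier;
  chart_at_atlas : forall p, atlas (chart_at p);
  chart_at_dom : forall p, cdom (chart_at p) p;
  atlas_smooth : forall phi psi, atlas phi -> atlas psi ->
    smooth_on (ccod phi `&` [set x | cdom psi (cinv phi x)])
              (fun x => cmap psi (cinv phi x)) }.

Section ManifoldCalculus.
Context {R : realType} {n : nat} {M : manifold R n}.
Implicit Types (phi : chart R n M) (p : M) (v w : 'rV[R]_n).

(* The tangent space T_p M is 'rV[R]_n, a tangent vector being given by its
   components in the chart [chart_at p]. *)

(* components in the chart phi of the vector v of T_p M *)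
Definition components phi p v : 'rV[R]_n :=
  'D_v (fun y => cmap phi (cinv (chart_at p) y)) (cmap (chart_at p) p).

Lemma components_chart_at p v : components (chart_at p) p v = v.
Proof.
have px : ccod (chart_at p) (cmap (chart_at p) p).
  by apply: cmap_cod; exact: chart_at_dom.
rewrite /components (@near_eq_derive _ _ _ _ id) ?derive_id//.
near=> y; apply: cinvK; near: y.
by apply: open_nbhs_nbhs; split => //; exact: ccod_open.
Unshelve. all: by end_near. Qed.

(* the i-th coordinate vector field of phi, at the point of coordinates x *)
Definition coordvec phi (x : 'rV[R]_n) (i : 'I_n) : 'rV[R]_n :=
  'D_(delta_mx 0 i) (fun y => cmap (chart_at (cinv phi x)) (cinv phi y)) x.

Definition smooth_function (f : M -> R) : Prop :=
  forall phi, atlas phi -> smooth_on (ccod phi) (fun x => f (cinv phi x)).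

Definition smooth_vector_field (Y : M -> 'rV[R]_n) : Prop :=
  forall phi, atlas phi ->
    smooth_on (ccod phi) (fun x => components phi (cinv phi x) (Y (cinv phi x))).

(* df_p(v) *)
Definition dfun (f : M -> R) p v : R :=
  'D_v (fun y => f (cinv (chart_at p) y)) (cmap (chart_at p) p).

Definition smooth_curve (I : set R) (alpha : R -> M) : Prop :=
  (forall s, I s -> {for s, continuous alpha}) /\
  (forall phi, atlas phi ->
    smooth_on (I `&` [set s | cdom phi (alpha s)])
              (fun s => cmap phi (alpha s))).

(* smoothness of the vector field X along alpha, where X s : T_(alpha s) M *)
Definition smooth_along (I : set R) (alpha : R -> M) (X : R -> 'rV[R]_n) : Prop :=
  forall phi, atlas phi ->
    smooth_on (I `&` [set s | cdom phi (alpha s)])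
              (fun s => components phi (alpha s) (X s)).

Definition velocity (alpha : R -> M) (s : R) : 'rV[R]_n :=
  derive1 (fun t => cmap (chart_at (alpha s)) (alpha t)) s.

End ManifoldCalculus.

(* Minkowski form diag(-1, 1, ..., 1) *)
Definition minkowski (R : realType) (n : nat) : 'M[R]_n :=
  diag_mx (\row_(i < n) (if i == 0%N :> nat then -1 else 1)).

(* [metric_mx p] is the Gram matrix of the scalar product of T_p M = 'rV[R]_n. *)
Record lorentz_metric (R : realType) (n : nat) (M : manifold R n) :=
    LorentzMetric {
  metric_mx : M -> 'M[R]_n;
  metric_sym : forall p, (metric_mx p)^T = metric_mx p;
  metric_signature : forall p, exists2 P : 'M[R]_n,
    P \in unitmx & P *m metric_mx p *m P^T = minkowski R n;
  metric_smooth : forall phi, atlas phi -> forall i j : 'I_n,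
    smooth_on (ccod phi) (fun x =>
      (coordvec phi x i *m metric_mx (cinv phi x) *m (coordvec phi x j)^T) 0 0)
  }.

Definition inner (R : realType) (n : nat) (M : manifold R n)
    (g : lorentz_metric M) (p : M) (v w : 'rV[R]_n) : R :=
  (v *m metric_mx g p *m w^T) 0 0.

Coercion inner : lorentz_metric >-> Funclass.

Section LeviCivita.
Context {R : realType} {n : nat} {M : manifold R n} (g : lorentz_metric M).
Implicit Types (phi : chart R n M) (p : M) (x v w : 'rV[R]_n) (i j k l : 'I_n).

Definition tnorm p v : R := Num.sqrt `|g p v v|.

(* X is a smooth timelike vector field, which selects the future cones *)
Definition time_orientation (X : M -> 'rV[R]_n) : Prop :=
  smooth_vector_field X /\ forall p, g p (X p) (X p) < 0.

(* matrix (g_ij) of the metric in the chart phi *)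
Definition gram phi x : 'M[R]_n :=
  \matrix_(i, j) g (cinv phi x) (coordvec phi x i) (coordvec phi x j).

(* d g_jl / d x^i *)
Definition dgram phi x i j l : R :=
  'D_(delta_mx 0 i) (fun y => gram phi y j l) x.

(* Christoffel symbols Gamma^k_ij of the Levi-Civita connection in phi *)
Definition christoffel phi x k i j : R :=
  2^-1 * \sum_l invmx (gram phi x) k l *
           (dgram phi x i j l + dgram phi x j i l - dgram phi x l i j).

(* the vector (Gamma^k_ij v^i w^j)_k *)
Definition gamma phi x v w : 'rV[R]_n :=
  \row_k \sum_i \sum_j christoffel phi x k i j * v 0 i * w 0 j.

(* nabla_v Y, for v in T_p M and Y a vector field *)
Definition nabla (Y : M -> 'rV[R]_n) p v : 'rV[R]_n :=
  let phi := chart_at p in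
  'D_v (fun x => components phi (cinv phi x) (Y (cinv phi x))) (cmap phi p)
  + gamma phi (cmap phi p) v (Y p).

(* nabla_(alpha') X at s, for X a vector field along alpha *)
Definition nabla_along (alpha : R -> M) (X : R -> 'rV[R]_n) (s : R) : 'rV[R]_n :=
  let phi := chart_at (alpha s) in
  derive1 (fun t => components phi (alpha t) (X t)) s
  + gamma phi (cmap phi (alpha s)) (velocity alpha s) (X s).

Definition acceleration (alpha : R -> M) : R -> 'rV[R]_n :=
  nabla_along alpha (velocity alpha).

(* Characterized by g(grad f, v) = df(v): see [gradP]. *)
Definition grad (f : M -> R) p : 'rV[R]_n :=
  (\row_i dfun f p (delta_mx 0 i)) *m invmx (metric_mx g p).

Definition hessian (f : M -> R) p v w : R := g p (nabla (grad f) p v) w.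

Lemma metric_unit p : metric_mx g p \in unitmx.
Proof.
have [P uP e] := metric_signature g p.
have : minkowski R n \in unitmx.
  rewrite unitmxE /minkowski det_diag unitfE; apply/prodf_neq0 => i _.
  by rewrite mxE; case: ifP => _; rewrite ?oppr_eq0 oner_eq0.
rewrite -e !unitmxE !det_mulmx !unitfE !mulf_eq0 !negb_or.
by case/andP => /andP[].
Qed.

Lemma gradP (f : M -> R) p v : smooth_function f ->
  g p (grad f p) v = dfun f p v.
Proof.
move=> sf; rewrite /inner /grad mulmxKV ?metric_unit//.
have : differentiable (fun y => f (cinv (chart_at p) y))
         (cmap (chart_at p) p).
  have [+ _] := sf _ (chart_at_atlas p) 1%N.
  by apply; apply: cmap_cod; exact: chart_at_dom.
move=> df; rewrite /dfun deriveE// {2}[v]row_sum_delta linear_sum mxE.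
apply: eq_bigr => i _.
by rewrite !mxE deriveE// linearZ/= mulrC.
Qed.

Lemma gram_sym phi x i j : gram phi x i j = gram phi x j i.
Proof.
have tr (A : 'M[R]_1) : A 0 0 = A^T 0 0 by rewrite mxE.
rewrite /gram mxE [RHS]mxE /inner [LHS]tr.
by rewrite !trmx_mul trmxK metric_sym mulmxA.
Qed.

Lemma dgram_sym phi x i j l : dgram phi x i j l = dgram phi x i l j.
Proof.
rewrite /dgram.
suff -> : (fun y => gram phi y j l) = (fun y => gram phi y l j) by [].
by apply: funext => y; exact: gram_sym.
Qed.

(* The connection is torsion-free ... *)
Lemma christoffel_torsion_free phi x k i j :
  christoffel phi x k i j = christoffel phi x k j i.
Proof.
rewrite /christoffel; congr (_ * _); apply: eq_bigr => l _.
congr (_ * _); rewrite [dgram _ _ i j l + _]addrC; congr (_ - _).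
exact: dgram_sym.
Qed.

(* ... and metric. *)
Lemma christoffel_metric phi x i j k : gram phi x \in unitmx ->
  dgram phi x k i j = \sum_l christoffel phi x l k i * gram phi x l j
                      + \sum_l christoffel phi x l k j * gram phi x l i.
Proof.
move=> ug.
have low a b c : \sum_l christoffel phi x l a b * gram phi x l c =
    2^-1 * (dgram phi x a b c + dgram phi x b a c - dgram phi x c a b).
  transitivity (2^-1 * \sum_m (gram phi x *m invmx (gram phi x)) c m *
      (dgram phi x a b m + dgram phi x b a m - dgram phi x m a b)).
    under eq_bigr do rewrite /christoffel -mulrA mulr_suml.
    rewrite -mulr_sumr exchange_big/=; congr (_ * _); apply: eq_bigr => m _.
    rewrite mxE mulr_suml; apply: eq_bigr => l _.
    by rewrite [gram phi x l c]gram_sym; ring.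
  congr (_ * _); rewrite mulmxV// (bigD1 c)//= big1 ?addr0; last first.
    by move=> m mc; rewrite mxE eq_sym (negbTE mc) mul0r.
  by rewrite mxE eqxx mul1r.
rewrite !low (dgram_sym phi x k j i) (dgram_sym phi x i k j)
  (dgram_sym phi x j k i) (dgram_sym phi x j i k).
by rewrite (dgram_sym phi x i j k); field.
Qed.

End LeviCivita.

Definition constant_on (R : realType) (I : set R) (h : R -> R) : Prop :=
  exists c, forall s, I s -> h s = c.

Definition nonzero_constant_on (R : realType) (I : set R) (h : R -> R) : Prop :=
  exists2 c, c != 0 & forall s, I s -> h s = c.

Section Curves.
Context {R : realType} {M : manifold R 3} (g : lorentz_metric M).
Implicit Types (I : set R) (alpha : R -> M) (f : M -> R) (V W : R -> 'rV[R]_3).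

Definition unit_speed I alpha (eps1 : R) : Prop :=
  (eps1 = 1 \/ eps1 = -1) /\
  forall s, I s -> g (alpha s) (velocity alpha s) (velocity alpha s) = eps1.

Definition frenet_curve I alpha : Prop :=
  forall s, I s ->
    g (alpha s) (acceleration g alpha s) (acceleration g alpha s) != 0.

Record frenet_frame I alpha (V1 V2 V3 : R -> 'rV[R]_3) (kappa tau : R -> R)
    (eps1 eps2 eps3 : R) : Prop := FrenetFrame {
  frenet_V1 : forall s, I s -> V1 s = velocity alpha s;
  frenet_smooth1 : smooth_along I alpha V1;
  frenet_smooth2 : smooth_along I alpha V2;
  frenet_smooth3 : smooth_along I alpha V3;
  frenet_smooth_kappa : smooth_on I kappa;
  frenet_smooth_tau : smooth_on I tau;
  frenet_eps1 : eps1 = 1 \/ eps1 = -1;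
  frenet_eps2 : eps2 = 1 \/ eps2 = -1;
  frenet_eps3 : eps3 = - eps1 * eps2;
  frenet_11 : forall s, I s -> g (alpha s) (V1 s) (V1 s) = eps1;
  frenet_22 : forall s, I s -> g (alpha s) (V2 s) (V2 s) = eps2;
  frenet_33 : forall s, I s -> g (alpha s) (V3 s) (V3 s) = eps3;
  frenet_12 : forall s, I s -> g (alpha s) (V1 s) (V2 s) = 0;
  frenet_13 : forall s, I s -> g (alpha s) (V1 s) (V3 s) = 0;
  frenet_23 : forall s, I s -> g (alpha s) (V2 s) (V3 s) = 0;
  frenet_kappa_ge0 : forall s, I s -> 0 <= kappa s;
  frenet_eq1 : forall s, I s ->
    nabla_along g alpha V1 s = (eps2 * kappa s) *: V2 s;
  frenet_eq2 : forall s, I s ->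
    nabla_along g alpha V2 s =
      - (eps1 * kappa s) *: V1 s - (eps3 * tau s) *: V3 s;
  frenet_eq3 : forall s, I s ->
    nabla_along g alpha V3 s = (eps2 * tau s) *: V2 s }.

Definition helix I (kappa tau : R -> R) : Prop :=
  constant_on I (fun s => tau s / kappa s).

Definition darboux (V1 V3 : R -> 'rV[R]_3) (kappa tau : R -> R) (s : R) :
    'rV[R]_3 :=
  tau s *: V1 s - kappa s *: V3 s.

Definition eikonal_along I alpha f : Prop :=
  constant_on I (fun s => tnorm g (alpha s) (grad g f (alpha s))).

Definition eikonal_slant_helix I alpha f V2 : Prop :=
  nonzero_constant_on I (fun s => g (alpha s) (grad g f (alpha s)) (V2 s)).

Definition eikonal_darboux_helix I alpha f W : Prop :=
  constant_on I (fun s => g (alpha s) (W s) (grad g f (alpha s))).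

End Curves.

(* Main.v *)
Require Import Defs.
From mathcomp Require Import all_boot all_order all_algebra.
From mathcomp Require Import all_classical all_reals all_analysis.
From mathcomp Require Import ring lra.

Set Implicit Arguments.
Unset Strict Implicit.
Unset Printing Implicit Defensive.

Import Order.TTheory GRing.Theory Num.Theory.
Import numFieldNormedType.Exports.

Local Open Scope classical_set_scope.
Local Open Scope ring_scope.

(** Since the Hessian of f vanishes, grad f is parallel, so by compatibility
of the Levi-Civita connection with the metric the frame components
u_i = g(grad f, V_i) have the derivatives g(grad f, nabla V_i)
([hessian0_derive]).  The Frenet equations turn this into the linear system
  u1' = e2 k u2,   u2' = - e1 k u1 - e3 t u3,   u3' = e2 t u2
in the curvature k and the torsion t, and the rest is an argument about this
system on an interval.  The quantities involved are
  q = e1 t^2 + e3 k^2 = g(W, W),      c0 = t u1 - k u3 = g(W, grad f),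
  h = e1 k u1 + e3 t u3 = - u2',      m = t' k - k' t.
As c0 is constant, t' u1 - k' u3 = 0.  The curve is not a helix, so m is not
identically 0, since (t/k)' = m / k^2; neither is q, because q = 0 on the whole
interval implies m = 0.

If u2 is a nonzero constant then h = 0.  Solving for u1 and u3 gives
q u1 = e1 t c0 and q u3 = - e3 k c0.  When c0 = 0, differentiating q u1 = 0
forces q = 0, which is excluded.  Otherwise K = e1 u1^2 + e3 u3^2 is constant
and q (q K - c0^2) = 0; at each point exactly one of the two factors vanishes,
and differentiating the product gives q' = 0 ([slant_darboux_norm_constant]).

Conversely let |q| be a nonzero constant, so that q' = 0.  Then k' and t' are
proportional to m, and t' u1 - k' u3 = 0 becomes m h = 0.  The difficulty is
that h is thereby known to vanish only where m does not: the curvatures might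
be constant on part of the interval and vary on another part.  Two facts rule
this out.  If c0 = 0, then u vanishes at any point where m does not; as (h, u2)
then satisfies a linear system with constant coefficients, u vanishes
everywhere, although grad f does not.  If c0 is not 0, then on the set where m
does not vanish, m is a fixed multiple of u2, and u2^2 is determined by the
constants q, c0 and g(grad f, grad f).  So m^2 takes only the values 0 and C
for a constant C, hence is constant, hence is C, which is not 0.  Therefore h
vanishes everywhere and u2 is a nonzero constant
([darboux_norm_constant_slant]). *)

(** * Differential calculus *)

(** The rules of differentiation are restated for functions given by explicit
formulas, so that derivations can be assembled as terms from the shape of the
formula. *)
Section PointwiseDerive.
Context {R : realType} {V : normedModType R}.
Implicit Types (f g : V -> R) (x v : V) (c df dg : R).

Lemma is_derive_cstF x v c : is_derive x v (fun=> c) 0.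
Proof. exact: is_derive_cst. Qed.

Lemma is_derive_addF f g x v df dg : is_derive x v f df -> is_derive x v g dg ->
  is_derive x v (fun y => f y + g y) (df + dg).
Proof. exact: is_deriveD. Qed.

Lemma is_derive_subF f g x v df dg : is_derive x v f df -> is_derive x v g dg ->
  is_derive x v (fun y => f y - g y) (df - dg).
Proof. exact: is_deriveB. Qed.

Lemma is_derive_mulF f g x v df dg : is_derive x v f df -> is_derive x v g dg ->
  is_derive x v (fun y => f y * g y) (df * g x + f x * dg).
Proof.
move=> hf hg; have := is_deriveM hf hg; move/is_derive_eq; apply.
by rewrite /GRing.scale/= addrC; congr (_ + _); rewrite mulrC.
Qed.

End PointwiseDerive.

Section DifferentiableMaps.
Context {R : realType}.

Lemma near_eq_differentiable (V W : normedModType R)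
    (f g : V -> W) (a : V) :
  (\forall x \near a, f x = g x) -> differentiable f a -> differentiable g a.
Proof.
move=> fg df.
have [df_cont /eqaddoP df_o] := (diff_locallyP _ _).1 df.
have ga : g a = f a by rewrite (nbhs_singleton fg).
have dg : g \o shift a = cst (g a) + 'd f a +o_ (0 : V) id.
  apply/eqaddoP => e e0; near=> h.
  have fgh : f (h + a) = g (h + a).
    near: h.
    have : (h + a @[h --> (0 : V)]) --> (0 + a).
      by apply: cvgD; [exact: cvg_id|exact: cvg_cst].
    by rewrite add0r => /(_ _ fg).
  rewrite ga; have : `|((f \o shift a) - (cst (f a) + 'd f a)) h| <= e * `|id h|.
    by near: h; exact: df_o.
  by rewrite /= !fctE /= fgh.
apply/diff_locallyP; rewrite (diff_unique df_cont dg).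
by split.
Unshelve. all: by end_near. Qed.

Lemma derive_comp (U V W : normedModType R) (f : U -> V)
    (g : V -> W) x v : differentiable f x -> differentiable g (f x) ->
  'D_v (fun y => g (f y)) x = 'D_('D_v f x) g (f x).
Proof.
move=> df dg; rewrite (deriveE _ dg) (deriveE _ df).
rewrite (@deriveE _ _ _ (g \o f)); last exact: differentiable_comp.
by rewrite diff_comp.
Qed.

Lemma derive_rV n (W : normedModType R) (f : 'rV[R]_n -> W) x v :
  differentiable f x -> 'D_v f x = \sum_i v 0 i *: 'D_(delta_mx 0 i) f x.
Proof.
move=> df; rewrite deriveE// {1}[v]row_sum_delta linear_sum.
by apply: eq_bigr => i _; rewrite linearZ/= deriveE.
Qed.

End DifferentiableMaps.

Section MatrixCalculus.
Context {R : realType} {V : normedModType R}.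

Lemma is_derive_sumF n (h : 'I_n -> V -> R) (x v : V) (dh : 'I_n -> R) :
  (forall i, is_derive x v (h i) (dh i)) ->
  is_derive x v (fun y => \sum_i h i y) (\sum_i dh i).
Proof. by move=> H; have := is_derive_sum H; rewrite fct_sumE. Qed.

Lemma differentiable_sumF (T : finType) (h : T -> V -> R) (x : V) :
  (forall i, differentiable (h i) x) -> differentiable (fun y => \sum_i h i y) x.
Proof.
move=> H; elim: (index_enum T) => [|a s IH].
  under eq_fun do rewrite big_nil; exact: differentiable_cst.
by under eq_fun do rewrite big_cons; exact: differentiableD.
Qed.

Lemma differentiable_prodF (T : finType) (h : T -> V -> R) (x : V) :
  (forall i, differentiable (h i) x) -> differentiable (fun y => \prod_i h i y) x.
Proof.
move=> H; elim: (index_enum T) => [|a s IH].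
  under eq_fun do rewrite big_nil; exact: differentiable_cst.
by under eq_fun do rewrite big_cons; exact: differentiableM.
Qed.

Lemma differentiable_det n (A : V -> 'M[R]_n) (x : V) :
  (forall i j, differentiable (fun y => A y i j) x) ->
  differentiable (fun y => \det (A y)) x.
Proof.
move=> hA; rewrite /determinant; apply: differentiable_sumF => s.
by apply: differentiableM => //; exact: differentiable_prodF.
Qed.

(** Cramer's rule: where A is invertible, the entries of its inverse are
cofactors divided by the determinant. *)
Lemma differentiable_invmx n (A : V -> 'M[R]_n) (x : V) :
  (forall i j, differentiable (fun y => A y i j) x) ->
  (\forall y \near x, A y \in unitmx) ->
  forall i j, differentiable (fun y => invmx (A y) i j) x.
Proof.
move=> hA uA i j.
have ux : A x \in unitmx := nbhs_singleton uA.
have near_inv : \forall y \near x,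
    (\det (A y))^-1 * cofactor (A y) j i = invmx (A y) i j.
  by near=> y; rewrite /invmx (near uA y)// !mxE.
apply: near_eq_differentiable near_inv _.
apply: differentiableM; first apply: differentiableV.
- exact: differentiable_det.
- by rewrite -unitfE -unitmxE.
- apply: differentiableM => //; apply: differentiable_det => k l.
  by under eq_fun do rewrite !mxE; exact: hA.
Unshelve. all: by end_near. Qed.

Lemma differentiable_rV n (A : V -> 'rV[R]_n) x :
  (forall i, differentiable (fun y => A y 0 i) x) -> differentiable A x.
Proof.
move=> dA.
have -> : A = \sum_i (fun y => A y 0 i *: delta_mx 0 i).
  by apply/funext => y; rewrite fct_sumE -row_sum_delta.
by apply: differentiable_sum => i; exact: differentiableZl.
Qed.

Lemma is_derive_entry m n (A : V -> 'M[R]_(m, n)) x v i j :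
  differentiable A x -> is_derive x v (fun y => A y i j) ('D_v A x i j).
Proof.
move=> dA; have hA : derivable A x v by exact: diff_derivable.
apply: DeriveDef; first by have /derivable_mxP := hA.
by rewrite derive_mx// mxE.
Qed.

End MatrixCalculus.

(** * Real functions on an interval *)

Section IntervalCalculus.
Context {R : realType} (I : set R) (hI : is_interval I).

Lemma interval_MVT (F dF : R -> R) a b :
  (forall s, I s -> is_derive s (1 : R) F (dF s)) -> I a -> I b -> a < b ->
  exists2 c, I c & F b - F a = dF c * (b - a).
Proof.
move=> hF Ia Ib ab.
have sub c : c \in `[a, b]%R -> I c.
  by rewrite in_itv/= => h; apply: (hI Ia Ib).
have [c cab e] : exists2 c, c \in `]a, b[%R & F b - F a = dF c * (b - a).
  apply: MVT => //.
    by move=> x xab; apply: hF; apply: sub; exact: subset_itv_oo_cc.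
  apply: derivable_within_continuous => x xab.
  by have [] := hF _ (sub _ xab).
by exists c => //; apply: sub; exact: subset_itv_oo_cc.
Qed.

Lemma derive0_constant (F : R -> R) :
  (forall s, I s -> is_derive s (1 : R) F 0) ->
  forall a b, I a -> I b -> F a = F b.
Proof.
move=> hF.
suff H a b : I a -> I b -> a < b -> F a = F b.
  by move=> a b Ia Ib; case: (ltgtP a b) => [/H->|/H->|->].
move=> Ia Ib ab; have [c _] := interval_MVT hF Ia Ib ab.
by rewrite mul0r => /eqP; rewrite subr_eq0 => /eqP.
Qed.

Lemma derive_ge0_le (F dF : R -> R) a b :
  (forall s, I s -> is_derive s (1 : R) F (dF s)) ->
  (forall s, I s -> 0 <= dF s) -> I a -> I b -> a <= b -> F a <= F b.
Proof.
move=> hF dF0 Ia Ib; rewrite le_eqVlt => /predU1P[->//|ab].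
have [c Ic e] := interval_MVT hF Ia Ib ab.
by rewrite -subr_ge0 e mulr_ge0 ?dF0// subr_ge0 ltW.
Qed.

Lemma is_derive_expM (C s : R) :
  is_derive s (1 : R) (fun x => expR (C * x)) (C * expR (C * s)).
Proof.
have h : is_derive s (1 : R) (fun x : R => C * x) C.
  have := is_derive_mulF (is_derive_cstF s 1 C) (is_derive_id s (1 : R)).
  by move/is_derive_eq; apply; rewrite mul0r mulr1 add0r.
have := @is_derive1_comp _ expR (fun x => C * x) s (expR (C * s)) C
  (is_derive_expR _) h.
by move/is_derive_eq; apply; rewrite mulrC.
Qed.

(** A Gronwall estimate: E = x^2 + y^2 satisfies |E'| <= C E with
C = |a + b|, so E exp(-C s) decreases and E exp(C s) increases; both are
nonnegative and vanish at s0. *)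
Lemma linear_system_unique (x y : R -> R) (a b s0 : R) :
  (forall s, I s -> is_derive s (1 : R) x (a * y s)) ->
  (forall s, I s -> is_derive s (1 : R) y (b * x s)) ->
  I s0 -> x s0 = 0 -> y s0 = 0 ->
  forall s, I s -> x s = 0 /\ y s = 0.
Proof.
move=> hx hy I0 x0 y0 s Is.
pose C := `|a + b|; pose E t := x t * x t + y t * y t.
have dE t : I t -> is_derive t (1 : R) E (2 * (a + b) * (x t * y t)).
  move=> It; have := is_derive_addF (is_derive_mulF (hx t It) (hx t It))
    (is_derive_mulF (hy t It) (hy t It)).
  by move/is_derive_eq; apply; ring.
have dF (c t : R) : I t -> is_derive t (1 : R) (fun r => E r * expR (c * r))
    ((2 * (a + b) * (x t * y t) + c * E t) * expR (c * t)).
  move=> It; have := is_derive_mulF (dE t It) (is_derive_expM c t).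
  by move/is_derive_eq; apply; ring.
have bnd t : `|2 * (a + b) * (x t * y t)| <= C * E t.
  rewrite mulrAC normrM mulrC ler_wpM2l//.
  rewrite ler_norml /E; apply/andP; split.
    by have := sqr_ge0 (x t + y t); nra.
  by have := sqr_ge0 (x t - y t); nra.
have E0 : E s0 = 0 by rewrite /E x0 y0 !mul0r addr0.
have Ele : E s <= 0.
  case: (leP s0 s) => [les|/ltW les].
    have := derive_ge0_le (F := fun r => - (E r * expR (- C * r))) _ _ I0 Is les.
    move=> /(_ (fun t => - ((2 * (a + b) * (x t * y t) + - C * E t) * expR (- C * t)))).
    rewrite E0 mul0r oppr0 oppr_ge0 pmulr_lle0 ?expR_gt0//; apply.
      by move=> t It; apply: is_deriveN; exact: dF.
    move=> t It; rewrite oppr_ge0 pmulr_lle0 ?expR_gt0// mulNr subr_le0.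
    exact: le_trans (ler_norm _) (bnd t).
  have := derive_ge0_le (F := fun r => E r * expR (C * r)) (dF C) _ Is I0 les.
  rewrite E0 mul0r pmulr_lle0 ?expR_gt0//; apply.
  move=> t It; rewrite mulr_ge0 ?expR_ge0//.
  by have := bnd t; rewrite ler_norml => /andP[+ _]; rewrite -subr_ge0 opprK.
have /eqP : E s = 0.
  by apply/eqP; rewrite eq_le Ele /E addr_ge0// -expr2 sqr_ge0.
rewrite /E -!expr2 paddr_eq0 ?sqr_ge0// !sqrf_eq0.
by case/andP => /eqP -> /eqP ->.
Qed.

End IntervalCalculus.

(** * The Frenet system of the components of a parallel field *)

Section FrenetSystem.
Context {R : realType} {I : set R} (Iopen : open I) (hI : is_interval I).
Variables (u1 u2 u3 k t dk dt ddk ddt : R -> R) (e1 e2 e3 c0 : R).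
Hypothesis he1 : e1 = 1 \/ e1 = -1.
Hypothesis he2 : e2 = 1 \/ e2 = -1.
Hypothesis he3 : e3 = - e1 * e2.
Hypothesis hk : forall s, I s -> is_derive s (1 : R) k (dk s).
Hypothesis ht : forall s, I s -> is_derive s (1 : R) t (dt s).
Hypothesis k0 : forall s, I s -> k s <> 0.
Hypothesis hu1 : forall s, I s -> is_derive s (1 : R) u1 (e2 * k s * u2 s).
Hypothesis hu2 : forall s, I s ->
  is_derive s (1 : R) u2 (- (e1 * k s * u1 s) - e3 * t s * u3 s).
Hypothesis hu3 : forall s, I s -> is_derive s (1 : R) u3 (e2 * t s * u2 s).
Hypothesis hc0 : forall s, I s -> t s * u1 s - k s * u3 s = c0.
Hypothesis nhelix : ~ helix I k t.

Let q s := e1 * t s ^+ 2 + e3 * k s ^+ 2.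
Let dq s := 2 * (e1 * t s * dt s + e3 * k s * dk s).
Let m s := dt s * k s - dk s * t s.
Let h s := e1 * k s * u1 s + e3 * t s * u3 s.

(** As I is open, an identity on I can be differentiated at each of its
points. *)
Lemma eq_on_open_derive (F G : R -> R) s dF dG : I s ->
  (forall r, I r -> F r = G r) ->
  is_derive s (1 : R) F dF -> is_derive s (1 : R) G dG -> dF = dG.
Proof.
move=> Is FG [_ <-] [_ <-]; apply: near_eq_derive.
by near=> r; apply: FG; near: r; exact: open_nbhs_nbhs.
Unshelve. all: by end_near. Qed.

(** The derivative of t / k is m / k^2. *)
Lemma wronskian_not_identically0 : (forall s, I s -> m s = 0) -> False.
Proof.
move=> m0; apply: nhelix.
have dr s : I s -> is_derive s (1 : R) (fun r => t r * (k r)^-1) 0.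
  move=> Is; have ks : k s != 0 by apply/eqP; exact: k0.
  have := is_derive_mulF (ht Is) (is_deriveV ks (hk Is)).
  move/is_derive_eq; apply; rewrite /GRing.scale/=.
  have -> : dt s = dk s * t s / k s.
    by apply: (mulIf ks); rewrite divfK//; have := m0 s Is; rewrite /m; lra.
  by field.
have [[s0 Is0]|nI] := pselect (exists s, I s).
  by exists (t s0 / k s0) => s Is; exact: (derive0_constant hI dr).
by exists 0 => s Is; case: nI; exists s.
Qed.

Lemma dq_derive s : I s -> is_derive s (1 : R) q (dq s).
Proof.
move=> Is.
have := is_derive_addF
  (is_derive_mulF (is_derive_cstF s 1 e1) (is_derive_mulF (ht Is) (ht Is)))
  (is_derive_mulF (is_derive_cstF s 1 e3) (is_derive_mulF (hk Is) (hk Is))).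
by move/is_derive_eq; apply; rewrite /dq; ring.
Qed.

(** If q = 0 then e1 t^2 = - e3 k^2, and t q' = 0 becomes e3 k m = 0. *)
Lemma q_not_identically0 : (forall s, I s -> q s = 0) -> False.
Proof.
move=> q0; apply: wronskian_not_identically0 => s Is.
have dq0 := eq_on_open_derive Is q0 (dq_derive Is) (is_derive_cstF s 1 0).
have := q0 s Is; rewrite /q => qs.
apply: (mulIf (x := e3 * k s)).
  rewrite he3 !mulf_neq0 ?oppr_eq0//; last exact/eqP/k0.
    by case: he1 => ->; rewrite ?oppr_eq0 oner_eq0.
  by case: he2 => ->; rewrite ?oppr_eq0 oner_eq0.
have A : dt s * (e1 * t s ^+ 2 + e3 * k s ^+ 2) = 0 by rewrite qs mulr0.
have B : t s * dq s = 0 by rewrite dq0 mulr0.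
by move: A B; rewrite /dq /m; lra.
Qed.

Lemma q_nonzero_constant : (forall s, I s -> dq s = 0) -> nonzero_constant_on I q.
Proof.
move=> dq0.
have qd s : I s -> is_derive s (1 : R) q 0.
  by move=> Is; have := dq_derive Is; rewrite dq0.
have [[s0 Is0]|nI] := pselect (exists s, I s); last first.
  by case: q_not_identically0 => s Is; case: nI; exists s.
have qc s : I s -> q s = q s0 by move=> Is; exact: (derive0_constant hI qd).
exists (q s0) => //; apply/eqP => q00.
by apply: q_not_identically0 => s Is; rewrite qc.
Qed.

Lemma darboux_helix_derive s : I s -> dt s * u1 s - dk s * u3 s = 0.
Proof.
move=> Is.
have := eq_on_open_derive Is hc0 (is_derive_subF
  (is_derive_mulF (ht Is) (hu1 Is)) (is_derive_mulF (hk Is) (hu3 Is)))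
  (is_derive_cstF s 1 c0).
by move=> <-; ring.
Qed.

(** The defining equations of c0 and h form a linear system for (u1, u3),
whose determinant is q up to sign; the next two lemmas are Cramer's rule. *)
Lemma q_u1 s : I s -> q s * u1 s = e1 * t s * c0 + e3 * e1 * k s * h s.
Proof.
by move=> Is; rewrite -(hc0 Is) /q /h he3; case: he1 => ->; case: he2 => ->; ring.
Qed.

Lemma q_u3 s : I s -> q s * u3 s = - e3 * k s * c0 + t s * h s * e1 * e3.
Proof.
by move=> Is; rewrite -(hc0 Is) /q /h he3; case: he1 => ->; case: he2 => ->; ring.
Qed.

(** Here h = 0.  For c0 = 0, the relation q u1 = 0 and its derivative give
q^2 e2 k c = 0.  For c0 != 0, q^2 K = c0^2 q with K constant, and its
derivative is (2 q K - c0^2) q' = 0, whose first factor is - c0^2 where q = 0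
and c0^2 where q K = c0^2. *)
Lemma slant_darboux_norm_constant : nonzero_constant_on I u2 ->
  nonzero_constant_on I q.
Proof.
case=> c c_neq0 u2c; apply: q_nonzero_constant.
have h0 s : I s -> h s = 0.
  move=> Is; have := eq_on_open_derive Is u2c (hu2 Is) (is_derive_cstF s 1 c).
  by rewrite /h; lra.
have [c00|c00] := eqVneq c0 0.
  case: q_not_identically0 => s Is.
  have qu1 r : I r -> q r * u1 r = 0.
    by move=> Ir; rewrite q_u1// h0// c00 !mulr0 addr0.
  have := eq_on_open_derive Is qu1 (is_derive_mulF (dq_derive Is) (hu1 Is))
    (is_derive_cstF s 1 0).
  rewrite u2c// => e.
  have : q s ^+ 2 * (e2 * k s * c) = 0.
    have e' := congr1 ( *%R (q s)) e; have e'' := congr1 ( *%R (dq s)) (qu1 s Is).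
    by move: e' e''; lra.
  move/eqP; rewrite !mulf_eq0 (negbTE c_neq0) orbF orbb.
  have /eqP/negbTE-> := k0 Is; rewrite orbF.
  suff /negbTE-> : e2 != 0 by rewrite orbF => /eqP.
  by case: he2 => ->; rewrite ?oppr_eq0 oner_eq0.
pose K s := e1 * (u1 s * u1 s) + e3 * (u3 s * u3 s).
have dK s : I s -> is_derive s (1 : R) K 0.
  move=> Is; have := is_derive_addF
    (is_derive_mulF (is_derive_cstF s 1 e1) (is_derive_mulF (hu1 Is) (hu1 Is)))
    (is_derive_mulF (is_derive_cstF s 1 e3) (is_derive_mulF (hu3 Is) (hu3 Is))).
  move/is_derive_eq; apply.
  by have := congr1 ( *%R (2 * e2 * u2 s)) (h0 s Is); rewrite /h; lra.
move=> s Is.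
have Kc r : I r -> K r = K s by move=> Ir; exact: (derive0_constant hI dK).
have qK r : I r -> q r * q r * K s - c0 ^+ 2 * q r = 0.
  move=> Ir; rewrite -(Kc r Ir).
  have -> : q r * q r * K r = e1 * (q r * u1 r) ^+ 2 + e3 * (q r * u3 r) ^+ 2.
    by rewrite /K; ring.
  rewrite q_u1// q_u3// h0// /q he3.
  by case: he1 => ->; case: he2 => ->; ring.
have := eq_on_open_derive Is qK (is_derive_subF (is_derive_mulF (is_derive_mulF
    (dq_derive Is) (dq_derive Is)) (is_derive_cstF s 1 (K s)))
    (is_derive_mulF (is_derive_cstF s 1 (c0 ^+ 2)) (dq_derive Is)))
  (is_derive_cstF s 1 0).
move=> e; have c2 : c0 ^+ 2 != 0 by rewrite expf_eq0.
have [qs|qs] := eqVneq (q s) 0.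
  by apply: (mulIf c2); move: e; rewrite qs; lra.
have qKs : q s * K s = c0 ^+ 2.
  by apply: (mulfI qs); have := qK s Is; lra.
apply: (mulIf c2).
have := congr1 ( *%R (2 * dq s)) qKs; lra.
Qed.

Hypothesis hdk : forall s, I s -> is_derive s (1 : R) dk (ddk s).
Hypothesis hdt : forall s, I s -> is_derive s (1 : R) dt (ddt s).
Hypothesis u_neq0 : exists2 s, I s & ~ [/\ u1 s = 0, u2 s = 0 & u3 s = 0].

Let dm s := ddt s * k s - ddk s * t s.

Lemma dm_derive s : I s -> is_derive s (1 : R) m (dm s).
Proof.
move=> Is; have := is_derive_subF (is_derive_mulF (hdt Is) (hk Is))
  (is_derive_mulF (hdk Is) (ht Is)).
by move/is_derive_eq; apply; rewrite /dm; ring.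
Qed.

(** The coefficient of u2 in h' is e2 (k^2 + e1 e3 t^2) = - q, as
e1 e2 e3 = -1. *)
Let dh s := e1 * dk s * u1 s + e3 * dt s * u3 s - q s * u2 s.

Lemma dh_derive s : I s -> is_derive s (1 : R) h (dh s).
Proof.
move=> Is; have := is_derive_addF
  (is_derive_mulF (is_derive_mulF (is_derive_cstF s 1 e1) (hk Is)) (hu1 Is))
  (is_derive_mulF (is_derive_mulF (is_derive_cstF s 1 e3) (ht Is)) (hu3 Is)).
move/is_derive_eq; apply; rewrite /dh /q he3.
by case: he1 => ->; case: he2 => ->; ring.
Qed.

(** The square of q is used because |q| is what is known to be constant.
The main point is that m vanishes nowhere; [m * h = 0] then gives h = 0. *)
Lemma darboux_norm_constant_slant :
  (exists2 d, d != 0 & forall s, I s -> q s ^+ 2 = d) -> nonzero_constant_on I u2.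
Proof.
case=> d d0 q2.
have qn0 s : I s -> q s != 0.
  by move=> Is; have := d0; rewrite -(q2 s Is) sqrf_eq0.
have dq0 s : I s -> dq s = 0.
  move=> Is.
  have := eq_on_open_derive Is q2 (is_derive_mulF (dq_derive Is) (dq_derive Is))
    (is_derive_cstF s 1 d).
  by move=> e; apply: (mulfI (qn0 s Is)); move: e; lra.
have [q0 q00 qc] := q_nonzero_constant dq0.
(* q' = 0 and the definition of m are two linear equations for k' and t' *)
have qdt s : I s -> q0 * dt s = e3 * k s * m s.
  move=> Is; rewrite -(qc s Is).
  by have := congr1 ( *%R (t s)) (dq0 s Is); rewrite /dq /q /m; lra.
have qdk s : I s -> q0 * dk s = - e1 * t s * m s.
  move=> Is; rewrite -(qc s Is).
  by have := congr1 ( *%R (k s)) (dq0 s Is); rewrite /dq /q /m; lra.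
have mh s : I s -> m s * h s = 0.
  move=> Is; have := congr1 ( *%R q0) (darboux_helix_derive Is).
  rewrite mulrBr mulr0 !mulrA qdt// qdk// /h he3.
  by case: he1 => ->; case: he2 => ->; lra.
have qdh s : I s -> q0 * dh s = - m s * c0 - q0 ^+ 2 * u2 s.
  move=> Is; rewrite /dh qc// -(hc0 Is).
  have -> : q0 * (e1 * dk s * u1 s + e3 * dt s * u3 s - q0 * u2 s) =
    e1 * (q0 * dk s) * u1 s + e3 * (q0 * dt s) * u3 s - q0 ^+ 2 * u2 s by ring.
  rewrite qdt// qdk// he3.
  by case: he1 => ->; case: he2 => ->; ring.
have [s1 Is1 m1] : exists2 s, I s & m s != 0.
  apply: contrapT => H; apply: wronskian_not_identically0 => s Is.
  by apply/eqP/negP => /negP ms; apply: H; exists s.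
have h_m s : I s -> m s != 0 -> h s = 0.
  by move=> Is ms; apply: (mulfI ms); rewrite mh// mulr0.
(* differentiate m h = 0 at a point where h = 0 *)
have u2_m s : I s -> m s != 0 -> m s * c0 = - q0 ^+ 2 * u2 s.
  move=> Is ms; have hs := h_m s Is ms.
  have e := eq_on_open_derive Is mh (is_derive_mulF (dm_derive Is) (dh_derive Is))
    (is_derive_cstF s 1 0).
  have dhs : dh s = 0.
    by apply: (mulfI ms); move: e; rewrite hs; lra.
  by have := qdh s Is; rewrite dhs; lra.
have [c00|c00] := eqVneq c0 0.
  (* h and u2 vanish at s1, hence everywhere *)
  have u21 : u2 s1 = 0.
    have := u2_m s1 Is1 m1; rewrite c00 mulr0 => /eqP.
    by rewrite eq_sym mulf_eq0 oppr_eq0 sqrf_eq0 (negbTE q00)/= => /eqP.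
  have dhc s : I s -> is_derive s (1 : R) h (- q0 * u2 s).
    move=> Is; have := dh_derive Is; move/is_derive_eq; apply.
    by apply: (mulfI q00); rewrite qdh// c00; ring.
  have du2 s : I s -> is_derive s (1 : R) u2 (-1 * h s).
    by move=> Is; have := hu2 Is; move/is_derive_eq; apply; rewrite /h; ring.
  have hu := linear_system_unique hI dhc du2 Is1 (h_m _ Is1 m1) u21.
  case: u_neq0 => s Is []; have [hs us] := hu s Is.
  split => //; apply: (mulfI (qn0 s Is)); rewrite mulr0.
    by rewrite (q_u1 Is) hs c00 !mulr0 addr0.
  by rewrite (q_u3 Is) hs c00 !(mulr0, mul0r) addr0.
pose K s := e1 * (u1 s * u1 s) + e2 * (u2 s * u2 s) + e3 * (u3 s * u3 s).
have dK s : I s -> is_derive s (1 : R) K 0.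
  move=> Is; have := is_derive_addF (is_derive_addF
    (is_derive_mulF (is_derive_cstF s 1 e1) (is_derive_mulF (hu1 Is) (hu1 Is)))
    (is_derive_mulF (is_derive_cstF s 1 e2) (is_derive_mulF (hu2 Is) (hu2 Is))))
    (is_derive_mulF (is_derive_cstF s 1 e3) (is_derive_mulF (hu3 Is) (hu3 Is))).
  by move/is_derive_eq; apply; ring.
have Kc s : I s -> K s = K s1 by move=> Is; exact: (derive0_constant hI dK).
(* C is the value of m^2 obtained from q0^2 u2^2 = m^2 c0^2 / q0^2 after u2^2
   is eliminated with the help of the constant K *)
pose C := e2 * q0 ^+ 3 * (q0 * K s1 - c0 ^+ 2) / c0 ^+ 2.
have mC s : I s -> m s != 0 -> m s ^+ 2 = C.
  move=> Is ms.
  have c2 : c0 ^+ 2 != 0 by rewrite sqrf_eq0.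
  apply: (mulIf c2); rewrite /C divfK// -exprMn u2_m// -(Kc s Is).
  apply: (mulfI q00).
  have -> : q0 * (e2 * q0 ^+ 3 * (q0 * K s - c0 ^+ 2)) =
    e2 * q0 ^+ 3 * (e1 * (q0 * u1 s) ^+ 2 + e3 * (q0 * u3 s) ^+ 2 +
       e2 * q0 ^+ 2 * u2 s ^+ 2 - q0 * c0 ^+ 2) by rewrite /K; ring.
  have -> : e1 * (q0 * u1 s) ^+ 2 + e3 * (q0 * u3 s) ^+ 2 = q0 * c0 ^+ 2.
    rewrite -(qc s Is) (q_u1 Is) (q_u3 Is) (h_m s Is ms) /q he3.
    by case: he1 => ->; case: he2 => ->; ring.
  by case: he2 => ->; ring.
have C0 : C != 0 by rewrite -(mC s1)// sqrf_eq0.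
(* m^2 (m^2 - C) = 0 on I; its derivative is (2 m^2 - C) (m^2)', in which the
   first factor is C where m^2 = C, and the second is 2 m m' = 0 where m = 0 *)
have dm2 s : I s -> is_derive s (1 : R) (fun r => m r * m r) 0.
  move=> Is; have mm := is_derive_mulF (dm_derive Is) (dm_derive Is).
  have [ms|ms] := eqVneq (m s) 0; first by move/is_derive_eq: mm; apply; rewrite ms; ring.
  have P r : I r -> m r * m r * (m r * m r) - C * (m r * m r) = 0.
    move=> Ir; have [->|mr] := eqVneq (m r) 0; first by ring.
    by rewrite -(mC r Ir mr); ring.
  have e := eq_on_open_derive Is P (is_derive_subF (is_derive_mulF mm mm)
    (is_derive_mulF (is_derive_cstF s 1 C) mm)) (is_derive_cstF s 1 0).
  move/is_derive_eq: mm; apply.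
  by apply: (mulfI C0); move: e; rewrite -(mC s Is ms); lra.
have mn0 s : I s -> m s != 0.
  move=> Is; have := derive0_constant hI dm2 Is Is1.
  by rewrite -!expr2 (mC s1 Is1 m1) => e; rewrite -sqrf_eq0 e.
have du2 s : I s -> is_derive s (1 : R) u2 0.
  move=> Is; have := hu2 Is; move/is_derive_eq; apply.
  by have := h_m s Is (mn0 s Is); rewrite /h; lra.
exists (u2 s1); last by move=> s Is; exact: (derive0_constant hI du2).
apply/eqP => u21; have /eqP := u2_m s1 Is1 m1.
by rewrite u21 mulr0 mulf_eq0 (negbTE m1) (negbTE c00).
Qed.

End FrenetSystem.

(** * Tangent vectors and the metric in a chart *)

Section Charts.
Context {R : realType} {n : nat} {M : manifold R n}.
Implicit Types (phi psi : chart R n M) (p : M) (x v w : 'rV[R]_n).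

Definition transition phi psi x : 'rV[R]_n := cmap psi (cinv phi x).

Lemma transition_differentiable phi psi x : atlas phi -> atlas psi ->
  ccod phi x -> cdom psi (cinv phi x) -> differentiable (transition phi psi) x.
Proof.
move=> aphi apsi cx dx.
by have [+ _] := atlas_smooth aphi apsi 1%N; apply; split.
Qed.

Lemma near_transition_dom phi psi x : ccod phi x -> cdom psi (cinv phi x) ->
  \forall y \near x, ccod phi y /\ cdom psi (cinv phi y).
Proof.
move=> cx dx; apply: filterI.
  by apply: open_nbhs_nbhs; split => //; exact: ccod_open.
apply: (cinv_cont cx).
by apply: open_nbhs_nbhs; split => //; exact: cdom_open.
Qed.

(** The transition maps between two charts are mutually inverse, hence so are
their differentials; everything about changes of coordinates below comes from
this. *)
Lemma derive_transitionK phi psi x v : atlas phi -> atlas psi ->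
  ccod phi x -> cdom psi (cinv phi x) ->
  'D_('D_v (transition phi psi) x) (transition psi phi) (transition phi psi x) = v.
Proof.
move=> aphi apsi cx dx.
have d1 := transition_differentiable aphi apsi cx dx.
have d2 : differentiable (transition psi phi) (transition phi psi x).
  apply: transition_differentiable => //; first exact: cmap_cod.
  by rewrite /transition cmapK//; exact: cinv_dom.
rewrite -(derive_comp v d1 d2) (@near_eq_derive _ _ _ _ id) ?derive_id//.
apply: filterS (near_transition_dom cx dx) => y [cy dy].
by rewrite /transition cmapK// cinvK.
Qed.

Lemma components_coordvec phi x i : atlas phi -> ccod phi x ->
  components phi (cinv phi x) (coordvec phi x i) = delta_mx 0 i.
Proof.
move=> aphi cx; apply: (derive_transitionK (psi := chart_at (cinv phi x))) => //.
  exact: chart_at_atlas.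
exact: chart_at_dom.
Qed.

Lemma components_sum phi p v : atlas phi -> cdom phi p ->
  v = \sum_i (components phi p v) 0 i *: coordvec phi (cmap phi p) i.
Proof.
move=> aphi dp.
have cp : ccod (chart_at p) (cmap (chart_at p) p).
  by apply: cmap_cod; exact: chart_at_dom.
have e := @derive_transitionK (chart_at p) phi _ v (chart_at_atlas p) aphi cp.
rewrite cmapK in e; last exact: chart_at_dom.
have tp : transition (chart_at p) phi (cmap (chart_at p) p) = cmap phi p.
  by rewrite /transition cmapK//; exact: chart_at_dom.
rewrite -{1}(e dp) tp.
rewrite derive_rV; last first.
  apply: transition_differentiable => //; first exact: chart_at_atlas.
    exact: cmap_cod.
  by rewrite cmapK//; exact: chart_at_dom.
apply: eq_bigr => i _; congr (_ *: _).
by rewrite /coordvec /transition cmapK.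
Qed.

End Charts.

Section MetricInChart.
Context {R : realType} {n : nat} {M : manifold R n} (g : lorentz_metric M).
Implicit Types (phi : chart R n M) (p : M) (x v w : 'rV[R]_n).

Lemma innerC p v w : g p v w = g p w v.
Proof.
have tr (A : 'M[R]_1) : A 0 0 = A^T 0 0 by rewrite mxE.
by rewrite /inner [LHS]tr !trmx_mul trmxK Defs.metric_sym mulmxA.
Qed.

Lemma inner_linearl p a v v' w : g p (a *: v + v') w = a * g p v w + g p v' w.
Proof. by rewrite /inner !mulmxDl -!scalemxAl mxE [X in X + _]mxE. Qed.

Lemma innerDl p v v' w : g p (v + v') w = g p v w + g p v' w.
Proof. by have := inner_linearl p 1 v v' w; rewrite scale1r mul1r. Qed.

Lemma inner0l p w : g p 0 w = 0.
Proof. by rewrite /inner !mul0mx mxE. Qed.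

Lemma innerZl p a v w : g p (a *: v) w = a * g p v w.
Proof. by have := inner_linearl p a v 0 w; rewrite inner0l !addr0. Qed.

Lemma innerDr p v w w' : g p v (w + w') = g p v w + g p v w'.
Proof. by rewrite innerC innerDl !(innerC _ v). Qed.

Lemma innerZr p a v w : g p v (a *: w) = a * g p v w.
Proof. by rewrite innerC innerZl (innerC _ v). Qed.

Lemma inner_suml p m (v : 'I_m -> 'rV[R]_n) w :
  g p (\sum_i v i) w = \sum_i g p (v i) w.
Proof.
by elim/big_rec2: _ => [|i y1 y2 _ <-]; rewrite ?inner0l// innerDl.
Qed.

Lemma inner_sumr p m v (w : 'I_m -> 'rV[R]_n) :
  g p v (\sum_i w i) = \sum_i g p v (w i).
Proof. by rewrite innerC inner_suml; apply: eq_bigr => i _; rewrite innerC. Qed.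

Lemma inner_gram phi p v w : atlas phi -> cdom phi p ->
  g p v w = \sum_i \sum_j components phi p v 0 i *
     gram g phi (cmap phi p) i j * components phi p w 0 j.
Proof.
move=> aphi dp.
rewrite {1}(components_sum v aphi dp) {1}(components_sum w aphi dp).
rewrite inner_suml; apply: eq_bigr => i _.
rewrite inner_sumr; apply: eq_bigr => j _.
by rewrite innerZl innerZr mxE cmapK//; ring.
Qed.

(** The Gram matrix is congruent to the one of [metric_mx] through the
matrix J of the coordinate vectors, and J is invertible because taking
components in the chart inverts it. *)
Lemma gram_unit phi x : atlas phi -> ccod phi x -> gram g phi x \in unitmx.
Proof.
move=> aphi cx; set p := cinv phi x.
have dp : cdom phi p by exact: cinv_dom.
pose J := \matrix_(i, j) coordvec phi x i 0 j.
pose K := \matrix_(i, j) components phi p (delta_mx 0 i) 0 j.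
have KJ : K *m J = 1%:M.
  apply/matrixP => i j; rewrite !mxE.
  have /rowP/(_ j) := components_sum (delta_mx 0 i) aphi dp.
  rewrite summxE !mxE eqxx/= eq_sym => ->.
  by apply: eq_bigr => k _; rewrite !mxE cinvK.
have [_ uJ] := mulmx1_unit KJ.
have -> : gram g phi x = J *m metric_mx g p *m J^T.
  apply/matrixP => i j; rewrite mxE /inner -/p.
  have rowJ k : coordvec phi x k = row k J by apply/rowP => l; rewrite !mxE.
  rewrite !rowJ -row_mul !mxE; apply: eq_bigr => l _.
  by rewrite !mxE.
by rewrite !unitmx_mul uJ metric_unit unitmx_tr.
Qed.

Lemma gram_differentiable phi x i j : atlas phi -> ccod phi x ->
  differentiable (fun y => gram g phi y i j) x.
Proof.
move=> aphi cx.
under eq_fun do rewrite mxE.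
by have [+ _] := metric_smooth g aphi i j 1%N; apply.
Qed.

End MetricInChart.

(** * Covariant derivatives along a curve *)

Section CovariantDerivative.
Context {R : realType} {n : nat} {M : manifold R n} (g : lorentz_metric M).
Implicit Types (phi : chart R n M) (p : M) (x v w : 'rV[R]_n).

(** [christoffel_metric] contracted with three vectors: the derivative of the
coefficients of the metric is absorbed by the Christoffel terms of the two
covariant derivatives. *)
Lemma gamma_metric phi x v (y z : 'rV[R]_n) : gram g phi x \in unitmx ->
  \sum_i \sum_j y 0 i * (\sum_k v 0 k * dgram g phi x k i j) * z 0 j =
  \sum_i \sum_j gamma g phi x v y 0 i * gram g phi x i j * z 0 j +
  \sum_i \sum_j y 0 i * gram g phi x i j * gamma g phi x v z 0 j.
Proof.
move=> ug.
pose T i j k l := christoffel g phi x l k i * v 0 k * y 0 i * gram g phi x l j * z 0 j.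
pose S i j k l := christoffel g phi x l k j * v 0 k * z 0 j * gram g phi x l i * y 0 i.
transitivity (\sum_i \sum_j \sum_k \sum_l T i j k l +
              \sum_i \sum_j \sum_k \sum_l S i j k l).
  rewrite -big_split; apply: eq_bigr => i _; rewrite -big_split; apply: eq_bigr => j _.
  rewrite mulr_sumr mulr_suml -big_split; apply: eq_bigr => k _ /=.
  rewrite christoffel_metric// !mulrDr mulrDl !mulr_sumr !mulr_suml.
  by congr (_ + _); apply: eq_bigr => l _; rewrite /T /S; ring.
congr (_ + _).
  transitivity (\sum_l \sum_j \sum_k \sum_i T i j k l); last first.
    apply: eq_bigr => l _; apply: eq_bigr => j _.
    rewrite [(gamma g phi x v y) 0 l]mxE !mulr_suml.
    by apply: eq_bigr => k _; rewrite !mulr_suml; apply: eq_bigr.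
  rewrite exchange_big/= [RHS]exchange_big/=; apply: eq_bigr => j _.
  transitivity (\sum_k \sum_i \sum_l T i j k l); first exact: exchange_big.
  rewrite [RHS]exchange_big/=; apply: eq_bigr => k _; exact: exchange_big.
apply: eq_bigr => i _.
transitivity (\sum_l \sum_k \sum_j S i j k l); last first.
  apply: eq_bigr => l _; rewrite [(gamma g phi x v z) 0 l]mxE mulr_sumr.
  apply: eq_bigr => k _; rewrite mulr_sumr; apply: eq_bigr => j _.
  by rewrite /S (gram_sym g phi x i l); ring.
rewrite exchange_big/= [RHS]exchange_big/=; apply: eq_bigr => k _.
exact: exchange_big.
Qed.

(** The product rule for y G z, whose middle term is rewritten by means of
corrections gy and gz to the derivatives of y and z. *)
Lemma form_product_rule (G dG : 'I_n -> 'I_n -> R) (y z dy dz gy gz : 'rV[R]_n) :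
  \sum_i \sum_j y 0 i * dG i j * z 0 j =
    \sum_i \sum_j gy 0 i * G i j * z 0 j + \sum_i \sum_j y 0 i * G i j * gz 0 j ->
  \sum_i \sum_j ((dy 0 i * G i j + y 0 i * dG i j) * z 0 j
                 + y 0 i * G i j * dz 0 j) =
  \sum_i \sum_j (dy + gy) 0 i * G i j * z 0 j +
  \sum_i \sum_j y 0 i * G i j * (dz + gz) 0 j.
Proof.
move=> E.
have add2 (A B : 'I_n -> 'I_n -> R) :
    \sum_i \sum_j A i j + \sum_i \sum_j B i j = \sum_i \sum_j (A i j + B i j).
  by rewrite -big_split; apply: eq_bigr => i _; rewrite -big_split.
transitivity (\sum_i \sum_j (dy 0 i * G i j * z 0 j + y 0 i * G i j * dz 0 j) +
    \sum_i \sum_j y 0 i * dG i j * z 0 j).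
  by rewrite add2; apply: eq_bigr => i _; apply: eq_bigr => j _; ring.
rewrite E !add2; apply: eq_bigr => i _; apply: eq_bigr => j _.
by rewrite !mxE; ring.
Qed.

Lemma smooth_along_differentiable (I : set R) (alpha : R -> M) Y s phi :
  smooth_along I alpha Y -> atlas phi -> I s -> cdom phi (alpha s) ->
  differentiable (fun t => components phi (alpha t) (Y t)) s.
Proof.
by move=> sY aphi Is ds; have [+ _] := sY phi aphi 1%N; apply; split.
Qed.

(** Compatibility of the connection with the metric, along a curve; the
computation takes place in the preferred chart at the point considered, in
terms of which [nabla_along] is defined. *)
Lemma metric_compatible (alpha : R -> M) (Y Z : R -> 'rV[R]_n) s :
  let phi := chart_at (alpha s) in
  {for s, continuous alpha} ->
  differentiable (fun t => cmap phi (alpha t)) s ->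
  differentiable (fun t => components phi (alpha t) (Y t)) s ->
  differentiable (fun t => components phi (alpha t) (Z t)) s ->
  is_derive s (1 : R) (fun t => g (alpha t) (Y t) (Z t))
    (g (alpha s) (nabla_along g alpha Y s) (Z s) +
     g (alpha s) (Y s) (nabla_along g alpha Z s)).
Proof.
move=> phi ca dx dY dZ.
have aphi : atlas phi by exact: chart_at_atlas.
have ds : cdom phi (alpha s) by exact: chart_at_dom.
pose x t := cmap phi (alpha t).
pose y t := components phi (alpha t) (Y t).
pose z t := components phi (alpha t) (Z t).
have cx : ccod phi (x s) by exact: cmap_cod.
have nd : \forall t \near s, cdom phi (alpha t).
  by apply: ca; apply: open_nbhs_nbhs; split => //; exact: cdom_open.
have dG i j : is_derive s (1 : R) (fun t => gram g phi (x t) i j)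
    (\sum_k ('D_1 x s) 0 k * dgram g phi (x s) k i j).
  have dg := gram_differentiable g i j aphi cx.
  apply: DeriveDef.
    by apply: diff_derivable; exact: (differentiable_comp dx dg).
  by rewrite (derive_comp (1 : R) dx dg) derive_rV.
have H : is_derive s (1 : R)
    (fun t => \sum_i \sum_j y t 0 i * gram g phi (x t) i j * z t 0 j)
    (g (alpha s) (nabla_along g alpha Y s) (Z s) +
     g (alpha s) (Y s) (nabla_along g alpha Z s)).
  have := is_derive_sumF (fun i => is_derive_sumF (fun j =>
    is_derive_mulF (is_derive_mulF (is_derive_entry (1 : R) 0 i dY) (dG i j))
      (is_derive_entry (1 : R) 0 j dZ))).
  move/is_derive_eq; apply.
  rewrite !(inner_gram g _ _ aphi ds) !(components_chart_at (alpha s)).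
  rewrite /nabla_along !derive1E -/(x s).
  have -> : Y s = y s by rewrite /y components_chart_at.
  have -> : Z s = z s by rewrite /z components_chart_at.
  have -> : velocity alpha s = 'D_1 x s by rewrite /velocity derive1E.
  have E := gamma_metric ('D_1 x s) (y s) (z s) (gram_unit g aphi cx).
  exact: form_product_rule.
apply: near_eq_is_derive H.
by near=> t; rewrite (inner_gram g _ _ aphi (near nd t _)).
Unshelve. all: by end_near. Qed.

End CovariantDerivative.

(** * Gradients with vanishing Hessian *)

Section Gradient.
Context {R : realType} {n : nat} {M : manifold R n} (g : lorentz_metric M).
Implicit Types (phi : chart R n M) (p : M) (x v w : 'rV[R]_n).

Lemma dfun_coordvec (f : M -> R) phi x i : smooth_function f ->
  atlas phi -> ccod phi x ->
  dfun f (cinv phi x) (coordvec phi x i) =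
  'D_(delta_mx 0 i) (fun y => f (cinv phi y)) x.
Proof.
move=> sf aphi cx; set p := cinv phi x; set psi := chart_at p.
have apsi : atlas psi by exact: chart_at_atlas.
have dp : cdom psi p by exact: chart_at_dom.
have dT := transition_differentiable aphi apsi cx dp.
have df : differentiable (fun y => f (cinv psi y)) (transition phi psi x).
  by have [+ _] := sf _ apsi 1%N; apply; exact: cmap_cod.
rewrite /dfun /coordvec -/p -/psi -(derive_comp _ dT df).
apply: near_eq_derive.
apply: filterS (near_transition_dom cx dp) => y [_ dy].
by rewrite /transition cmapK.
Qed.

Lemma components_grad (f : M -> R) phi x : smooth_function f ->
  atlas phi -> ccod phi x ->
  components phi (cinv phi x) (grad g f (cinv phi x)) =
  (\row_i 'D_(delta_mx 0 i) (fun y => f (cinv phi y)) x) *m invmx (gram g phi x).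
Proof.
move=> sf aphi cx; set p := cinv phi x.
apply: (canRL (mulmxK (gram_unit g aphi cx))).
apply/rowP => j; rewrite !mxE -(dfun_coordvec j sf aphi cx) -(gradP g _ _ sf).
rewrite (inner_gram g _ _ aphi (cinv_dom cx)) cinvK// components_coordvec//.
apply: eq_bigr => i _; rewrite (bigD1 j)//= big1 => [|k kj].
  by rewrite [(delta_mx _ _) _ _]mxE !eqxx mulr1 addr0.
by rewrite [(delta_mx _ _) _ _]mxE (negbTE kj) mulr0.
Qed.

(** The derivatives ['D_v] in [nabla] carry information only for
differentiable maps, so this is what makes the hypothesis on the Hessian
usable. *)
Lemma components_grad_differentiable (f : M -> R) phi x : smooth_function f ->
  atlas phi -> ccod phi x ->
  differentiable (fun y => components phi (cinv phi y) (grad g f (cinv phi y))) x.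
Proof.
move=> sf aphi cx.
have nc : \forall y \near x, ccod phi y.
  by apply: open_nbhs_nbhs; split => //; exact: ccod_open.
apply: (near_eq_differentiable (f := fun y =>
   (\row_i 'D_(delta_mx 0 i) (fun y => f (cinv phi y)) y) *m invmx (gram g phi y))).
  by apply: filterS nc => y cy; rewrite components_grad.
apply: differentiable_rV => i.
under eq_fun do rewrite mxE; apply: differentiable_sumF => j.
apply: differentiableM.
  under eq_fun do rewrite mxE.
  by have [_ /(_ (delta_mx 0 j))[+ _]] := sf _ aphi 2%N; apply.
apply: differentiable_invmx; first by move=> k l; exact: gram_differentiable.
by apply: filterS nc => y cy; exact: gram_unit.
Qed.

(** Both sides have the same Christoffel term; the first terms agree by the
chain rule. *)
Lemma nabla_along_grad (f : M -> R) (alpha : R -> M) s : smooth_function f ->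
  {for s, continuous alpha} ->
  differentiable (fun t => cmap (chart_at (alpha s)) (alpha t)) s ->
  nabla_along g alpha (fun t => grad g f (alpha t)) s =
  nabla g (grad g f) (alpha s) (velocity alpha s).
Proof.
move=> sf ca dx; rewrite /nabla_along /nabla.
set phi := chart_at (alpha s) in dx *; set c := gamma _ _ _ _ _.
suff -> : (fun t => components phi (alpha t) (grad g f (alpha t)))^`()%classic s =
    'D_(velocity alpha s) (fun x => components phi (cinv phi x)
      (grad g f (cinv phi x))) (cmap phi (alpha s)) by [].
have ds : cdom phi (alpha s) by exact: chart_at_dom.
have dg := components_grad_differentiable sf (chart_at_atlas (alpha s))
  (cmap_cod ds).
rewrite /velocity -/phi !derive1E -(derive_comp _ dx dg).
apply: near_eq_derive.
have : \forall t \near s, cdom phi (alpha t).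
  by apply: ca; apply: open_nbhs_nbhs; split => //; exact: cdom_open.
by apply: filterS => t dt; rewrite cmapK.
Qed.

Lemma components_grad_along_differentiable (f : M -> R) (alpha : R -> M) s phi :
  smooth_function f -> {for s, continuous alpha} ->
  atlas phi -> cdom phi (alpha s) ->
  differentiable (fun t => cmap phi (alpha t)) s ->
  differentiable (fun t => components phi (alpha t) (grad g f (alpha t))) s.
Proof.
move=> sf ca aphi ds dx.
have nd : \forall t \near s, cdom phi (alpha t).
  by apply: ca; apply: open_nbhs_nbhs; split => //; exact: cdom_open.
have dg := components_grad_differentiable sf aphi (cmap_cod ds).
apply: near_eq_differentiable (differentiable_comp dx dg).
by apply: filterS nd => t dt /=; rewrite cmapK.
Qed.

(** In the product rule for g(grad f, Y) the term with the covariant derivative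
of grad f is a value of the Hessian. *)
Lemma hessian0_derive (f : M -> R) (I : set R) (alpha : R -> M) Y s :
  smooth_function f -> (forall p v w, hessian g f p v w = 0) ->
  smooth_curve I alpha -> smooth_along I alpha Y -> I s ->
  is_derive s (1 : R) (fun t => g (alpha t) (grad g f (alpha t)) (Y t))
    (g (alpha s) (grad g f (alpha s)) (nabla_along g alpha Y s)).
Proof.
move=> sf hess [ca sa] sY Is.
have ds : cdom (chart_at (alpha s)) (alpha s) by exact: chart_at_dom.
have aphi := chart_at_atlas (alpha s).
have dx : differentiable (fun t => cmap (chart_at (alpha s)) (alpha t)) s.
  by have [+ _] := sa _ aphi 1%N; apply.
have := metric_compatible g (Y := fun t => grad g f (alpha t)) (ca s Is) dx
  (components_grad_along_differentiable sf (ca s Is) aphi ds dx)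
  (smooth_along_differentiable sY aphi Is ds).
move/is_derive_eq; apply.
rewrite nabla_along_grad//; last exact: ca.
by have := hess (alpha s) (velocity alpha s) (Y s); rewrite /hessian => ->; rewrite add0r.
Qed.

End Gradient.

(** * Eikonal slant helices and Darboux helices *)

(** The matrix P of the frame is invertible because P G P^T is diagonal with
nonzero entries, and v G P^T = 0. *)
Lemma orthogonal_frame_nondegenerate (R : realType) n (M : manifold R n)
    (g : lorentz_metric M) p (V : 'I_n -> 'rV[R]_n) (e : 'I_n -> R) (v : 'rV[R]_n) :
  (forall i j, g p (V i) (V j) = e i *+ (i == j)) -> (forall i, e i != 0) ->
  (forall i, g p v (V i) = 0) -> v = 0.
Proof.
move=> VV e0 vV; pose P := \matrix_i V i.
have innerP (w : 'rV[R]_n) j : (w *m metric_mx g p *m P^T) 0 j = g p w (V j).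
  rewrite /inner !mxE; apply: eq_bigr => k _; congr (_ * _).
  by rewrite [P^T _ _]mxE [P _ _]mxE [_^T _ _]mxE.
have PGP : P *m metric_mx g p *m P^T = diag_mx (\row_i e i).
  apply/matrixP => i j.
  transitivity (row i (P *m metric_mx g p *m P^T) 0 j); first by rewrite [RHS]mxE.
  rewrite !row_mul rowK innerP VV mxE.
  by rewrite [(\row_i e i) _ _]mxE.
have : P *m metric_mx g p *m P^T \in unitmx.
  rewrite PGP unitmxE det_diag unitfE; apply/prodf_neq0 => i _.
  by rewrite mxE.
rewrite !unitmx_mul => /andP[_ uPT].
have : v *m metric_mx g p *m P^T = 0.
  by apply/rowP => j; rewrite innerP vV mxE.
move/(canRL (mulmxK uPT)); rewrite mul0mx.
by move/(canRL (mulmxK (metric_unit g p))); rewrite mul0mx.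
Qed.

Theorem theorem2p3 (R : realType) (M : manifold R 3) (g : lorentz_metric M)
    (X : M -> 'rV[R]_3) (hX : time_orientation g X)
    (I : set R) (hIopen : open I) (hI : is_interval I)
    (alpha : R -> M) (halpha : smooth_curve I alpha)
    (V1 V2 V3 : R -> 'rV[R]_3) (kappa tau : R -> R) (eps1 eps2 eps3 : R)
    (hunit : unit_speed g I alpha eps1)
    (hfrenet : frenet_curve g I alpha)
    (hframe : frenet_frame g I alpha V1 V2 V3 kappa tau eps1 eps2 eps3)
    (hkappa : forall s, I s -> kappa s <> 0)
    (htau : forall s, I s -> tau s <> 0)
    (hnothelix : ~ helix I kappa tau)
    (f : M -> R) (hf : smooth_function f)
    (heikonal : eikonal_along g I alpha f)
    (hgrad : exists2 s, I s & grad g f (alpha s) <> 0)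
    (hhess : forall (p : M) (v w : 'rV[R]_3), hessian g f p v w = 0)
    (hdarboux : eikonal_darboux_helix g I alpha f (darboux V1 V3 kappa tau)) :
  eikonal_slant_helix g I alpha f V2 <->
  nonzero_constant_on I
    (fun s => tnorm g (alpha s) (darboux V1 V3 kappa tau s)).
Proof.
case: hframe => _ sV1 sV2 sV3 sk st he1 he2 he3 g11 g22 g33 g12 g13 g23 _ n1 n2 n3.
pose u (V : R -> 'rV[R]_3) s := g (alpha s) (grad g f (alpha s)) (V s).
have du V (sV : smooth_along I alpha V) s (Is : I s) :=
  hessian0_derive hf hhess halpha sV Is.
have du1 s : I s -> is_derive s (1 : R) (u V1) (eps2 * kappa s * u V2 s).
  by move=> Is; have := du V1 sV1 s Is; rewrite n1// innerZr.
have du2 s : I s -> is_derive s (1 : R) (u V2)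
    (- (eps1 * kappa s * u V1 s) - eps3 * tau s * u V3 s).
  move=> Is; have := du V2 sV2 s Is; rewrite n2//.
  by rewrite -[- (_ *: V3 s)]scaleNr innerDr !innerZr !mulNr.
have du3 s : I s -> is_derive s (1 : R) (u V3) (eps2 * tau s * u V2 s).
  by move=> Is; have := du V3 sV3 s Is; rewrite n3// innerZr.
have dk (h : R -> R) (sh : smooth_on I h) s (Is : I s) :
    is_derive s (1 : R) h ('D_1 h s).
  apply/derivableP/diff_derivable.
  by have [+ _] := sh 1%N; apply.
have ddk (h : R -> R) (sh : smooth_on I h) s (Is : I s) :
    is_derive s (1 : R) ('D_1 h) ('D_1 ('D_1 h) s).
  apply/derivableP/diff_derivable.
  by have [_ /(_ 1)[+ _]] := sh 2%N; apply.
have [c0 hc0] : constant_on I (fun s => tau s * u V1 s - kappa s * u V3 s).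
  case: hdarboux => c hc; exists c => s Is; rewrite -(hc s Is) /darboux.
  by rewrite innerC -[- (_ *: V3 s)]scaleNr innerDr !innerZr mulNr.
have WW s : I s -> g (alpha s) (darboux V1 V3 kappa tau s) (darboux V1 V3 kappa tau s)
    = eps1 * tau s ^+ 2 + eps3 * kappa s ^+ 2.
  move=> Is; rewrite /darboux -[- (_ *: V3 s)]scaleNr !(innerDl, innerDr, innerZl, innerZr).
  by rewrite (innerC g _ (V3 s)) g11// g33// g13//; ring.
split.
  move=> slant.
  have [c c0' hc] := slant_darboux_norm_constant hIopen hI he1 he2 he3 (dk _ sk) (dk _ st)
    hkappa du1 du2 du3 hc0 hnothelix slant.
  exists (Num.sqrt `|c|); first by rewrite sqrtr_eq0 -ltNge normr_gt0.
  by move=> s Is; rewrite /tnorm WW// hc.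
case=> c c0' hc.
apply: (darboux_norm_constant_slant hIopen hI he1 he2 he3 (dk _ sk) (dk _ st)
    hkappa du1 du2 du3 hc0 hnothelix (ddk _ sk) (ddk _ st)).
  case: hgrad => s Is gs; exists s => // -[us1 us2 us3]; apply: gs.
  apply: (orthogonal_frame_nondegenerate (g := g) (p := alpha s)
    (V := fun i : 'I_3 => [:: V1 s; V2 s; V3 s]`_i)
    (e := fun i : 'I_3 => [:: eps1; eps2; eps3]`_i)).
  - by case=> [[|[|[|i]]] hi] [[|[|[|j]]] hj] //=;
      rewrite ?(g11, g22, g33, g12, g13, g23)// innerC ?(g12, g13, g23).
  - case=> [[|[|[|i]]] hi] //=; rewrite ?he3.
    + by case: he1 => ->; rewrite ?oppr_eq0 oner_eq0.
    + by case: he2 => ->; rewrite ?oppr_eq0 oner_eq0.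
    + by case: he1 => ->; case: he2 => ->; rewrite ?opprK ?mul1r ?mulN1r ?oppr_eq0 oner_eq0.
  - by case=> [[|[|[|i]]] hi].
(* c = sqrt |q|, so c^4 = q^2 *)
exists (c ^+ 4); first by rewrite expf_neq0.
move=> s Is; rewrite -(hc s Is) /tnorm WW//.
by rewrite (exprM _ 2 2) sqr_sqrtr// real_normK// num_real.
Qed.
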